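(* Let $m\ge1$, $h\ge1$, $I=\{1,\dots,m\}$, $H=\{0,\dots,h-1\}$, $p^t\ge0$ and $x^{0t}\ge0$ for $t\in H$, $\gamma^i>0$ for $i\in I$, and suppose the sets $X^i$, $i\in I$, are nonempty and compact. Then the set $N$ of Nash equilibria of the game with pay-offs $f(\cdot,x^{-i})$ and constraint sets $X^i$, $i\in I$, coincides with the set of minimizers of the auxiliary problem $\mathcal P_a$: $$N=\arg\min_{\{x^i\in X^i\}_{i\in I}}\ f_0(x)+\sum_{i\in I}\big[f(x^i,x^{-i})+f_a(x^i)\big].$$
   Context: Agent $i\in I$ has decision vector $x^i=(x^{it})_{t\in H}\in\mathbb{R}^h$ and constraint set $$X^i=\Big\{x^i\in\mathbb{R}^h:\ \sum_{t\in H}x^{it}=\gamma^i,\ x^{it}\in[\underline{x}^{it},\overline{x}^{it}]\ \forall t\in H\Big\},\qquad \underline{x}^{it}\ge0,\ \overline{x}^{it}<\infty .$$ Write $x=(x^1,\dots,x^m)\in X=X^1\times\dots\times X^m$ and let $x^{-i}$ denote the decisions of all agents other than $i$; $x$ is also written $(x^i,x^{-i})$. Define $$f(x^i,x^{-i})=\sum_{t\in H}x^{it}p^t\Big(\sum_{j\in I,\,j\ne i}x^{jt}+x^{it}+x^{0t}\Big),$$ $$f_0(x)=\sum_{t\in H}x^{0t}p^t\Big(\sum_{j\in I}x^{jt}+x^{0t}\Big),\qquad f_a(x^i)=\sum_{t\in H}p^t(x^{it})^2 .$$ The set of Nash equilibria is $$N=\{x\in X:\ f(x^i,x^{-i})\le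 f(\zeta^i,x^{-i})\ \text{for all }\zeta^i\in X^i,\ i\in I\}.$$ Problem $\mathcal P_a$ is the minimization of $f_0(x)+\sum_{i\in I}[f(x^i,x^{-i})+f_a(x^i)]$ over $x\in X$. *)

(* Defs.v *)
From mathcomp Require Import all_boot all_order all_algebra.
From mathcomp Require Import all_classical all_reals all_analysis.

Set Implicit Arguments.
Unset Strict Implicit.
Unset Printing Implicit Defensive.

Import Order.TTheory GRing.Theory Num.Theory.
Import numFieldNormedType.Exports.

Local Open Scope classical_set_scope.
Local Open Scope ring_scope.

(** A decision vector in R^h is a row vector ['rV[R]_h]; the family
    [(x^1, ..., x^m)] is a map ['I_m -> 'rV[R]_h]. The parameters [p t] are
    scalar coefficients, multiplying the expression that follows them. *)

Definition agent_set (R : realType) (h : nat) (g : R) (lo up : 'rV[R]_h) :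
    set 'rV[R]_h :=
  [set xi | \sum_(t < h) xi 0 t = g /\
            forall t, xi 0 t \in `[lo 0 t, up 0 t]].

Definition joint_set (R : realType) (m h : nat) (X : 'I_m -> set 'rV[R]_h) :
    set ('I_m -> 'rV[R]_h) :=
  [set x | forall i, X i (x i)].

(** [payoff p x0 i xi x] is [f(x^i, x^{-i})] with first argument [xi]; of the
    profile [x] only the components [x j] with [j != i], i.e. [x^{-i}], are
    used, so that [payoff p x0 i zeta x] is a unilateral deviation to [zeta]. *)
Definition payoff (R : realType) (m h : nat) (p x0 : 'rV[R]_h) (i : 'I_m)
    (xi : 'rV[R]_h) (x : 'I_m -> 'rV[R]_h) : R :=
  \sum_(t < h) xi 0 t * p 0 t *
    (\sum_(j < m | j != i) x j 0 t + xi 0 t + x0 0 t).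

Definition payoff0 (R : realType) (m h : nat) (p x0 : 'rV[R]_h)
    (x : 'I_m -> 'rV[R]_h) : R :=
  \sum_(t < h) x0 0 t * p 0 t * (\sum_(j < m) x j 0 t + x0 0 t).

Definition payoff_a (R : realType) (h : nat) (p xi : 'rV[R]_h) : R :=
  \sum_(t < h) p 0 t * xi 0 t ^+ 2.

Definition nash_equilibria (R : realType) (m h : nat) (p x0 : 'rV[R]_h)
    (X : 'I_m -> set 'rV[R]_h) : set ('I_m -> 'rV[R]_h) :=
  [set x | joint_set X x /\
           forall (i : 'I_m) (zeta : 'rV[R]_h), X i zeta ->
             payoff p x0 i (x i) x <= payoff p x0 i zeta x].

Definition argmin (R : realType) (T : Type) (A : set T) (F : T -> R) : set T :=
  [set x | A x /\ forall y, A y -> F x <= F y].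

Definition auxiliary_objective (R : realType) (m h : nat) (p x0 : 'rV[R]_h)
    (x : 'I_m -> 'rV[R]_h) : R :=
  payoff0 p x0 x + \sum_(i < m) (payoff p x0 i (x i) x + payoff_a p (x i)).

(* Main.v *)
(** The objective equals [\sum_t p^t ((\sum_j x^jt + x^0t)^2 + \sum_j (x^jt)^2)],
    a convex quadratic, and a unilateral deviation changes it by exactly twice
    the change of the deviating agent's payoff: it is a potential of the game.
    Hence minimizers are equilibria. Conversely, at an equilibrium [x] the
    first-order conditions of the agents' convex problems add up to the
    first-order condition of the joint problem, whose quadratic remainder is
    nonnegative. *)

Require Import Defs.
From mathcomp Require Import all_boot all_order all_algebra.
From mathcomp Require Import all_classical all_reals all_analysis.
From mathcomp Require Import ring lra.

Import Order.TTheory GRing.Theory Num.Theory.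
Import numFieldNormedType.Exports.

Local Open Scope classical_set_scope.
Local Open Scope ring_scope.

(** If [a < 0], the step [s = -a / (b - a)] makes the expression equal to [s ^+ 2 * a < 0]. Unlike
    the vertex [-a / (2 * b)], this [s] lies in []0, 1]] for every [b >= 0], so no case split is
    required. *)
Lemma quadratic_ge0_slope (R : realFieldType) (a b : R) :
  0 <= b -> (forall s, 0 <= s <= 1 -> 0 <= s * a + s ^+ 2 * b) -> 0 <= a.
Proof.
move=> b0 H; rewrite leNgt; apply/negP => a0.
have ba : 0 < b - a by rewrite subr_gt0 (lt_le_trans a0).
pose s := - a / (b - a).
have s0 : 0 < s by rewrite divr_gt0 ?oppr_gt0.
have s1 : s <= 1 by rewrite ler_pdivrMr // mul1r; lra.
have : 0 <= s * a + s ^+ 2 * b by apply: H; rewrite (ltW s0) s1.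
have -> : s * a + s ^+ 2 * b = - (s * s * - a).
  by rewrite /s; field; rewrite gt_eqF.
by rewrite oppr_ge0 leNgt (mulr_gt0 (mulr_gt0 s0 s0)) ?oppr_gt0.
Qed.

Lemma agent_set_segment (R : realType) (h : nat) (g : R) (lo up xi zeta : 'rV[R]_h)
    (s : R) : 0 <= s <= 1 ->
  agent_set g lo up xi -> agent_set g lo up zeta ->
  agent_set g lo up (xi + s *: (zeta - xi)).
Proof.
move=> /andP[s0 s1] [xg xb] [zg zb]; split.
  under eq_bigr do rewrite !mxE.
  by rewrite big_split -mulr_sumr big_split sumrN /= xg zg; ring.
move=> t; move: (xb t) (zb t); rewrite !in_itv /= !mxE.
by move=> /andP[? ?] /andP[? ?]; apply/andP; split; nra.
Qed.

Section Potential.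
Variables (R : realType) (m h : nat) (p x0 : 'rV[R]_h).
Implicit Types x y : 'I_m -> 'rV[R]_h.

(** Directional derivative of agent [i]'s payoff at its own decision: the extra [x i 0 t] comes from
    the product rule. *)
Definition payoff_slope x (i : 'I_m) (d : 'rV[R]_h) : R :=
  \sum_(t < h) p 0 t * d 0 t * (\sum_(j < m) x j 0 t + x0 0 t + x i 0 t).

Lemma payoff_slopeZ x i s d :
  payoff_slope x i (s *: d) = s * payoff_slope x i d.
Proof.
by rewrite /payoff_slope mulr_sumr; apply: eq_bigr => t _; rewrite mxE; ring.
Qed.

Lemma payoff_aZ s (d : 'rV[R]_h) : payoff_a p (s *: d) = s ^+ 2 * payoff_a p d.
Proof.
by rewrite /payoff_a mulr_sumr; apply: eq_bigr => t _; rewrite mxE; ring.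
Qed.

(** The payoff is quadratic in the agent's own decision, so its second-order Taylor expansion is
    exact. *)
Lemma payoff_sub x i zeta :
  payoff p x0 i zeta x - payoff p x0 i (x i) x =
    payoff_slope x i (zeta - x i) + payoff_a p (zeta - x i).
Proof.
rewrite /payoff /payoff_slope /payoff_a -sumrB -big_split.
apply: eq_bigr => t _ /=; rewrite !mxE [in RHS](bigD1 i) //=; ring.
Qed.

(** All agents face the same total at time [t]; the weights [x i 0 t] and [x0 0 t] multiplying it
    add up to that total again, which produces the square. *)
Lemma auxiliary_objectiveE x : auxiliary_objective p x0 x =
  \sum_(t < h) p 0 t *
    ((\sum_(j < m) x j 0 t + x0 0 t) ^+ 2 + \sum_(j < m) x j 0 t ^+ 2).
Proof.
rewrite /auxiliary_objective /payoff0 /payoff /payoff_a big_split /=.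
rewrite exchange_big [X in _ + (_ + X)]exchange_big /= -!big_split /=.
apply: eq_bigr => t _; rewrite -mulr_sumr.
have -> : \sum_(i < m) x i 0 t * p 0 t *
    (\sum_(j < m | j != i) x j 0 t + x i 0 t + x0 0 t) =
  (\sum_(i < m) x i 0 t) * (p 0 t * (\sum_(j < m) x j 0 t + x0 0 t)).
  rewrite mulr_suml; apply: eq_bigr => i _.
  rewrite [in RHS](bigD1 i) //=; ring.
ring.
Qed.

(** Exact Taylor expansion of the joint quadratic: its partial gradient in each [x i] is twice that
    of agent [i]'s payoff. *)
Lemma auxiliary_objective_sub x y :
  auxiliary_objective p x0 y - auxiliary_objective p x0 x =
    2 * \sum_(i < m) payoff_slope x i (y i - x i) +
    (\sum_(t < h) p 0 t * (\sum_(i < m) (y i - x i) 0 t) ^+ 2 +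
     \sum_(i < m) payoff_a p (y i - x i)).
Proof.
rewrite !auxiliary_objectiveE /payoff_slope /payoff_a.
rewrite exchange_big [X in _ + (_ + X)]exchange_big /=.
rewrite -sumrB mulr_sumr -!big_split; apply: eq_bigr => t _ /=.
have -> : \sum_(i < m) p 0 t * (y i - x i) 0 t *
    (\sum_(j < m) x j 0 t + x0 0 t + x i 0 t) =
  p 0 t * ((\sum_(i < m) (y i - x i) 0 t) * (\sum_(j < m) x j 0 t + x0 0 t)
           + \sum_(i < m) (y i - x i) 0 t * x i 0 t).
  by rewrite mulr_suml -big_split mulr_sumr; apply: eq_bigr => i _ /=; ring.
have -> : \sum_(j < m) y j 0 t ^+ 2 = \sum_(j < m) x j 0 t ^+ 2
    + 2 * (\sum_(i < m) (y i - x i) 0 t * x i 0 t)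
    + \sum_(i < m) (y i - x i) 0 t ^+ 2.
  by rewrite mulr_sumr -!big_split; apply: eq_bigr => i _ /=; rewrite !mxE; ring.
have -> : \sum_(j < m) y j 0 t =
    \sum_(j < m) x j 0 t + \sum_(i < m) (y i - x i) 0 t.
  by rewrite -big_split; apply: eq_bigr => i _ /=; rewrite !mxE; ring.
rewrite -mulr_sumr; ring.
Qed.

(** When only agent [i] moves, the total displacement is its own, so both quadratic remainders equal
    [payoff_a p (zeta - x i)], which yields the factor 2 in second order too. *)
Lemma auxiliary_objective_deviation x i zeta :
  auxiliary_objective p x0 (fun j => if j == i then zeta else x j)
    - auxiliary_objective p x0 x =
  2 * (payoff p x0 i zeta x - payoff p x0 i (x i) x).
Proof.
have dE (F : 'I_m -> 'rV[R]_h -> R) : (forall j, F j 0 = 0) ->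
    \sum_(j < m) F j ((if j == i then zeta else x j) - x j) = F i (zeta - x i).
  move=> F0; rewrite (bigD1 i) //= eqxx big1 ?addr0 // => j /negbTE ->.
  by rewrite subrr.
rewrite auxiliary_objective_sub payoff_sub.
rewrite (dE (payoff_slope x)) => [|j]; last first.
  by rewrite -[0](scale0r 0) payoff_slopeZ mul0r.
rewrite (dE (fun=> payoff_a p)) => [|j]; last first.
  by rewrite -[0](scale0r 0) payoff_aZ expr0n mul0r.
under eq_bigr => t _ do rewrite (dE (fun _ d => d 0 t)) ?mxE //.
have -> : \sum_(t < h) p 0 t * (zeta 0 t - x i 0 t) ^+ 2 = payoff_a p (zeta - x i).
  by apply: eq_bigr => t _; rewrite !mxE.
ring.
Qed.

End Potential.

Theorem proposition4 (R : realType) (m h : nat) (p x0 : 'rV[R]_h)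
    (gamma : 'I_m -> R) (lo up : 'I_m -> 'rV[R]_h)
    (X := fun i : 'I_m => agent_set (gamma i) (lo i) (up i))
    (hm : (1 <= m)%N) (hh : (1 <= h)%N)
    (hp : forall t, 0 <= p 0 t) (hx0 : forall t, 0 <= x0 0 t)
    (hgamma : forall i, 0 < gamma i)
    (hlo : forall i t, 0 <= lo i 0 t)
    (hX0 : forall i, X i !=set0)
    (hXc : forall i, compact (X i)) :
  nash_equilibria p x0 X = argmin (joint_set X) (auxiliary_objective p x0).
Proof.
have pa0 d : 0 <= payoff_a p d.
  by apply: sumr_ge0 => t _; rewrite mulr_ge0 ?sqr_ge0.
apply/seteqP; split => x [xX xopt]; split=> //.
  move=> y yX; rewrite -subr_ge0 auxiliary_objective_sub.
  apply: addr_ge0; last first.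
    by rewrite addr_ge0 ?sumr_ge0 // => t _; rewrite mulr_ge0 ?sqr_ge0.
  rewrite mulr_ge0 // sumr_ge0 // => i _.
  (* Moving a fraction [s] towards [y i] is a feasible deviation, and it changes the payoff by [s]
     times the slope plus [s ^+ 2] times [payoff_a]. *)
  apply: (quadratic_ge0_slope _ _ _ (pa0 (y i - x i))) => s s01.
  have := xopt i _ (agent_set_segment _ _ _ _ _ _ _ _ s01 (xX i) (yX i)).
  by rewrite -subr_ge0 payoff_sub [_ + _ - _]addrC addKr payoff_slopeZ payoff_aZ.
(* Conversely, a unilateral deviation is compared with [x] through the doubled payoff difference. *)
move=> i zeta zX; rewrite -subr_ge0 -(pmulr_rge0 _ (ltr0n R 2)).
rewrite -auxiliary_objective_deviation subr_ge0; apply: xopt => j.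
by case: eqP => [->|_]; [exact: zX | exact: xX].
Qed.
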